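(* Let $t\in\mathbb{N}^+$, let $0<\alpha<2/L$, and suppose that $\mathcal{L}_t$ is a KL function. Let $\{\mathbf{y}_k\}$ be the sequence of NEAR-DGD$^t$ iterates produced with steplength $\alpha$, and let $\mathbf{y}^\infty$ be the limit point of a convergent subsequence of $\{\mathbf{y}_k\}$. Then: (i) there exists an index $k_0\in\mathbb{N}^+$ such that the KL inequality with respect to $\mathbf{y}^\infty$ holds for all $k\ge k_0$, i.e. $\phi'(\mathcal{L}_t(\mathbf{y}_k)-\mathcal{L}_t(\mathbf{y}^\infty))\,\|\nabla\mathcal{L}_t(\mathbf{y}_k)\|\ge 1$ for all $k\ge k_0$, where $\phi$ is the function in the KL property of $\mathcal{L}_t$ at $\mathbf{y}^\infty$; (ii) the sequence $\{\mathbf{y}_k\}$ converges to $\mathbf{y}^\infty$.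
   Context: Setting. Let $\mathcal{G}=(\mathcal{V},\mathcal{E})$ be a connected undirected graph with $\mathcal{V}=\{1,\dots,n\}$. Let $f_i:\mathbb{R}^p\to\mathbb{R}$, $i=1,\dots,n$, be differentiable (possibly nonconvex). For $\mathbf{x}=[x_1',\dots,x_n']'\in\mathbb{R}^{np}$ with $x_i\in\mathbb{R}^p$, put $\mathbf{f}(\mathbf{x})=\sum_{i=1}^n f_i(x_i)$. $\|\cdot\|$ is the Euclidean norm. Standing assumptions. (1) $\mathbf{W}\in\mathbb{R}^{n\times n}$ is symmetric, doubly stochastic, positive definite, and $w_{ij}>0$ if and only if $(i,j)\in\mathcal{E}$ or $i=j$, with $w_{ij}=0$ otherwise. (2) $\nabla\mathbf{f}$ is Lipschitz with constant $L>0$: $\|\nabla\mathbf{f}(\mathbf{x})-\nabla\mathbf{f}(\mathbf{y})\|\le L\|\mathbf{x}-\mathbf{y}\|$ for all $\mathbf{x},\mathbf{y}\in\mathbb{R}^{np}$. (3) $\mathbf{f}$ is coercive: $\mathbf{f}(\mathbf{x}_k)\to\infty$ for every sequence with $\|\mathbf{x}_k\|\to\infty$. Method. Let $\mathbf{Z}=\mathbf{W}\otimes I_p$, so $\mathbf{Z}^t=\mathbf{W}^t\otimes I_p$. For $t\in\mathbb{N}^+$, $\alpha>0$ and arbitrary $\mathbf{y}_0\in\mathbb{R}^{np}$, the NEAR-DGD$^t$ iterates are, for $k\ge 0$, $\mathbf{x}_k=\mathbf{Z}^t\mathbf{y}_k$ and $\mathbf{y}_{k+1}=\mathbf{x}_k-\alpha\nabla\mathbf{f}(\mathbf{x}_k)$.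 Lyapunov function. $\mathcal{L}_t(\mathbf{y})=\mathbf{f}(\mathbf{Z}^t\mathbf{y})+\frac{1}{2\alpha}\langle\mathbf{y},\mathbf{Z}^t\mathbf{y}\rangle-\frac{1}{2\alpha}\langle\mathbf{y},\mathbf{Z}^{2t}\mathbf{y}\rangle$. Under the standing assumptions and $\alpha<2/L$, $\{\mathbf{y}_k\}$ has a convergent subsequence whose limit point is a critical point of $\mathcal{L}_t$. KL (Kurdyka-Łojasiewicz) property, for a continuously differentiable $h:\mathbb{R}^N\to\mathbb{R}$. $h$ has the KL property at $x^\star$ if there exist $\eta\in(0,+\infty]$, a neighborhood $U$ of $x^\star$, and a continuous concave function $\phi:[0,\eta)\to\mathbb{R}^+$ such that $\phi(0)=0$, $\phi$ is $C^1$ on $(0,\eta)$, $\phi'(s)>0$ for all $s\in(0,\eta)$, and for all $x\in U$ with $h(x^\star)<h(x)<h(x^\star)+\eta$ the KL inequality $\phi'(h(x)-h(x^\star))\,\|\nabla h(x)\|\ge 1$ holds. $h$ is a KL function if it satisfies this at every point.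
   Formalization: Part (i) is stated as a dichotomy: either y_k = y^∞ for all k ≥ k_0 (where φ' would be evaluated at 0, outside (0,η), and ∇L_t = 0, so the KL inequality fails), or the KL inequality holds for all k ≥ k_0. *)

(* Defs.v *)
(* Mathematical Components with MathComp-Analysis *)
From mathcomp Require Import all_boot all_order all_algebra.
From mathcomp Require Import all_classical all_reals all_analysis.
From mathcomp Require Import mxtens.

Set Implicit Arguments.
Unset Strict Implicit.
Unset Printing Implicit Defensive.

Import Order.TTheory GRing.Theory Num.Theory.
Import numFieldNormedType.Exports.

Local Open Scope classical_set_scope.
Local Open Scope ring_scope.

(* The library norm of a matrix is the sup norm, hence [dotp] and [enorm] for
   the Euclidean structure of R^N; the topology is the same for both norms. *)
Definition dotp (R : realType) (N : nat) (u v : 'cV[R]_N) : R :=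
  (u^T *m v) 0 0.

Definition enorm (R : realType) (N : nat) (u : 'cV[R]_N) : R :=
  Num.sqrt (dotp u u).

(* Only meaningful where [h] is differentiable: ['D_v h x] is a default value
   when the directional derivative does not exist. *)
Definition grad (R : realType) (N : nat) (h : 'cV[R]_N -> R) (x : 'cV[R]_N) :
    'cV[R]_N :=
  \col_i 'D_(delta_mx i 0) h x.

Definition doubly_stochastic (R : realType) (n : nat) (W : 'M[R]_n) : Prop :=
  [/\ forall i j, 0 <= W i j,
      forall i, \sum_j W i j = 1
    & forall j, \sum_i W i j = 1].

Definition positive_definite (R : realType) (n : nat) (W : 'M[R]_n) : Prop :=
  forall u : 'cV[R]_n, u != 0 -> 0 < dotp u (W *m u).

Definition connected_graph (n : nat) (e : rel 'I_n) : Prop :=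
  symmetric e /\ forall i j, connect e i j.

Definition consensus_matrix (R : realType) (n : nat) (e : rel 'I_n)
    (W : 'M[R]_n) : Prop :=
  [/\ W^T = W,
      doubly_stochastic W,
      positive_definite W,
      forall i j, 0 < W i j <-> (e i j \/ i = j)
    & forall i j, ~ (e i j \/ i = j) -> W i j = 0].

(* x_i, for x = [x_1', ..., x_n']' *)
Definition block (R : realType) (n p : nat) (x : 'cV[R]_(n * p)) (i : 'I_n) :
    'cV[R]_p :=
  \col_j x (mxtens_index (i, j)) 0.

Definition sum_blocks (R : realType) (n p : nat) (f : 'I_n -> 'cV[R]_p -> R)
    (x : 'cV[R]_(n * p)) : R :=
  \sum_(i < n) f i (block x i).

Definition lipschitz_grad (R : realType) (N : nat) (L : R)
    (F : 'cV[R]_N -> R) : Prop :=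
  forall x y, enorm (grad F x - grad F y) <= L * enorm (x - y).

Definition coercive (R : realType) (N : nat) (F : 'cV[R]_N -> R) : Prop :=
  forall u : nat -> 'cV[R]_N,
    enorm (u k) @[k --> \oo] --> +oo -> F (u k) @[k --> \oo] --> +oo.

(* The Kronecker product of [W] and I_p: a square matrix, so that [^+] is the
   matrix power. *)
Definition kronI (R : realType) (n p : nat) (W : 'M[R]_n) : 'M[R]_(n * p) :=
  W *t (1%:M : 'M[R]_p).

Definition near_dgd (R : realType) (N : nat) (F : 'cV[R]_N -> R)
    (Z : 'M[R]_N) (t : nat) (alpha : R) (x y : nat -> 'cV[R]_N) : Prop :=
  forall k, x k = Z ^+ t *m y k /\ y k.+1 = x k - alpha *: grad F (x k).

Definition lyapunov (R : realType) (N : nat) (F : 'cV[R]_N -> R)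
    (Z : 'M[R]_N) (t : nat) (alpha : R) (y : 'cV[R]_N) : R :=
  F (Z ^+ t *m y) + (2 * alpha)^-1 * dotp y (Z ^+ t *m y)
    - (2 * alpha)^-1 * dotp y (Z ^+ (2 * t) *m y).

(* [phi], of interest on [0, eta) only, is a total function; its values
   elsewhere are irrelevant. *)
Definition desingularizing (R : realType) (eta : \bar R) (phi : R -> R) :
    Prop :=
  let D := [set s : R | 0 <= s /\ (s%:E < eta)%E] in
  [/\ [/\ {within D, continuous phi},
          (forall a b l : R, D a -> D b -> 0 <= l <= 1 ->
             l * phi a + (1 - l) * phi b <= phi (l * a + (1 - l) * b))
        & forall s : R, D s -> 0 <= phi s],
      phi 0 = 0,
      (forall s : R, 0 < s -> (s%:E < eta)%E ->
         derivable phi s 1 /\ {for s, continuous (derive1 phi)})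
    & forall s : R, 0 < s -> (s%:E < eta)%E -> 0 < derive1 phi s].

Definition KL_range (R : realType) (N : nat) (h : 'cV[R]_N -> R)
    (xs : 'cV[R]_N) (eta : \bar R) (x : 'cV[R]_N) : Prop :=
  h xs < h x /\ ((h x)%:E < (h xs)%:E + eta)%E.

Definition KL_inequality (R : realType) (N : nat) (h : 'cV[R]_N -> R)
    (xs : 'cV[R]_N) (phi : R -> R) (x : 'cV[R]_N) : Prop :=
  1 <= derive1 phi (h x - h xs) * enorm (grad h x).

Definition KL_data (R : realType) (N : nat) (h : 'cV[R]_N -> R)
    (xs : 'cV[R]_N) (eta : \bar R) (U : set 'cV[R]_N) (phi : R -> R) : Prop :=
  [/\ (0 < eta)%E,
      nbhs xs U,
      desingularizing eta phi
    & forall x, U x -> KL_range h xs eta x -> KL_inequality h xs phi x].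

Definition KL_property (R : realType) (N : nat) (h : 'cV[R]_N -> R)
    (xs : 'cV[R]_N) : Prop :=
  exists eta U phi, KL_data h xs eta U phi.

Definition KL_function (R : realType) (N : nat) (h : 'cV[R]_N -> R) : Prop :=
  forall xs, KL_property h xs.

(* Main.v *)
Require Import Defs.
From mathcomp Require Import all_boot all_order all_algebra.
From mathcomp Require Import all_classical all_reals all_analysis.
From mathcomp Require Import mxtens ring lra.

(* The iterates satisfy grad L_t(y_k) = -(1/alpha) Z^t (y_(k+1) - y_k) and, by
   the descent lemma and Z^t >= Z^(2t),
     L_t(y_(k+1)) <= L_t(y_k) - (1/alpha - L/2) |Z^t (y_(k+1) - y_k)|^2.
   The gradient norm and the decrease are thus both governed by
   g_k = |Z^t (y_(k+1) - y_k)|, and the KL inequality together with the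
   concavity of phi bounds g_k by a multiple of phi_k - phi_(k+1), where
   phi_k = phi(L_t(y_k) - L_t(yinf)).  As Z^t is invertible, g_k controls
   |y_(k+1) - y_k|, so |y_k - yinf| + C phi_k is nonincreasing as long as the
   iterates stay in the KL neighborhood; an element of the subsequence at which
   it is small enough traps all the later iterates. *)

Set Implicit Arguments.
Unset Strict Implicit.
Unset Printing Implicit Defensive.

Import Order.TTheory GRing.Theory Num.Theory.
Import numFieldNormedType.Exports.

Local Open Scope classical_set_scope.
Local Open Scope ring_scope.

(** * Euclidean inner product and norm, compared with the sup norm *)

Section Euclidean.
Variables (R : realType) (N : nat).
Implicit Types (u v w : 'cV[R]_N) (A : 'M[R]_N).

Lemma dotpE u v : dotp u v = \sum_i u i 0 * v i 0.
Proof. by rewrite /dotp mxE; apply: eq_bigr => i _; rewrite mxE. Qed.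

Lemma dotpC u v : dotp u v = dotp v u.
Proof. by rewrite !dotpE; apply: eq_bigr => i _; rewrite mulrC. Qed.

Lemma dotpDr u v w : dotp u (v + w) = dotp u v + dotp u w.
Proof. by rewrite /dotp mulmxDr mxE. Qed.

Lemma dotpZr a u v : dotp u (a *: v) = a * dotp u v.
Proof. by rewrite /dotp -scalemxAr mxE. Qed.

Lemma dotpNr u v : dotp u (- v) = - dotp u v.
Proof. by rewrite -scaleN1r dotpZr mulN1r. Qed.

Lemma dotp0r u : dotp u 0 = 0.
Proof. by rewrite /dotp mulmx0 mxE. Qed.

Lemma dotpDl u v w : dotp (u + v) w = dotp u w + dotp v w.
Proof. by rewrite dotpC dotpDr !(dotpC w). Qed.

Lemma dotpZl a u v : dotp (a *: u) v = a * dotp u v.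
Proof. by rewrite dotpC dotpZr dotpC. Qed.

Lemma dotpNl u v : dotp (- u) v = - dotp u v.
Proof. by rewrite dotpC dotpNr dotpC. Qed.

Lemma dotp_mulmx A u v : dotp (A *m u) v = dotp u (A^T *m v).
Proof. by rewrite /dotp trmx_mul mulmxA. Qed.

Lemma dotp_ge0 u : 0 <= dotp u u.
Proof. by rewrite dotpE; apply: sumr_ge0 => i _; rewrite -expr2 sqr_ge0. Qed.

Lemma sqr_coord_le_dotp u i : u i 0 ^+ 2 <= dotp u u.
Proof.
rewrite dotpE (bigD1 i) //= -expr2 lerDl.
by apply: sumr_ge0 => j _; rewrite -expr2 sqr_ge0.
Qed.

Lemma dotp_eq0 u : (dotp u u == 0) = (u == 0).
Proof.
apply/eqP/eqP => [u0|->]; last exact: dotp0r.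
apply/colP => i; rewrite mxE; apply/eqP; rewrite -sqrf_eq0 eq_le sqr_ge0 andbT.
by rewrite -u0 sqr_coord_le_dotp.
Qed.

Lemma enorm_ge0 u : 0 <= enorm u.
Proof. exact: sqrtr_ge0. Qed.

Lemma sqr_enorm u : enorm u ^+ 2 = dotp u u.
Proof. exact/sqr_sqrtr/dotp_ge0. Qed.

Lemma enormZ a u : enorm (a *: u) = `|a| * enorm u.
Proof.
rewrite /enorm dotpZl dotpZr mulrA -expr2 sqrtrM ?sqr_ge0 //.
by rewrite sqrtr_sqr.
Qed.

Lemma enormN u : enorm (- u) = enorm u.
Proof. by rewrite -scaleN1r enormZ normrN1 mul1r. Qed.

(** Cauchy-Schwarz: the squared norm of [dotp v v *: u - dotp u v *: v] is nonnegative and carries a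
    factor [dotp v v], which is divided out. *)
Lemma dotp_le_enorm u v : dotp u v <= enorm u * enorm v.
Proof.
have [->|v0] := eqVneq v 0.
  by rewrite dotp0r mulr_ge0 // enorm_ge0.
have vv0 : 0 < dotp v v by rewrite lt0r dotp_eq0 v0 dotp_ge0.
apply: le_trans (ler_norm _) _.
rewrite -ler_sqr ?nnegrE ?mulr_ge0 ?enorm_ge0 //.
rewrite exprMn !sqr_enorm real_normK ?num_real //.
have := dotp_ge0 (dotp v v *: u - dotp u v *: v).
rewrite dotpDl !dotpDr !dotpNl !dotpNr !dotpZl !dotpZr (dotpC v u).
set a := dotp u v; set b := dotp v v; set c := dotp u u => H.
rewrite -(ler_pM2l vv0) -/b -subr_ge0; apply: le_trans H _; lra.
Qed.

(** Carries Euclidean estimates over to the library norm, in which convergence is measured. *)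
Lemma mx_norm_le_enorm u : `|u| <= enorm u.
Proof.
rewrite [leLHS]mx_normrE; apply: bigmax_le => [|[i j] _].
  exact: enorm_ge0.
rewrite /= (ord1 j) -ler_sqr ?nnegrE ?enorm_ge0 //.
by rewrite sqr_enorm real_normK ?num_real // sqr_coord_le_dotp.
Qed.

Lemma coord_le_mx_norm u i : `|u i 0| <= `|u|.
Proof. by rewrite [leRHS]mx_normrE; apply: (le_bigmax _ _ (i, 0)). Qed.

End Euclidean.

(** * Boundedness and continuity of matrix multiplication *)

Lemma mulmx_bounded (R : realType) m N (A : 'M[R]_(m, N)) :
  exists2 b : R, 0 < b & forall u : 'cV[R]_N, `|A *m u| <= b * `|u|.
Proof.
(* The summand 1 keeps the bound positive when [A] is 0. *)
exists (1 + \sum_i \sum_j `|A i j|) => [|u].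
  by rewrite ltr_pwDl // sumr_ge0 // => i _; rewrite sumr_ge0.
rewrite [leLHS]mx_normrE; apply: bigmax_le => [|[i k] _] /=.
  by rewrite mulr_ge0 // addr_ge0 // sumr_ge0 // => i _; rewrite sumr_ge0.
rewrite (ord1 k) mxE; apply: le_trans (ler_norm_sum _ _ _) _.
apply: (@le_trans _ _ (\sum_j `|A i j| * `|u|)).
  by apply: ler_sum => j _; rewrite normrM ler_wpM2l // coord_le_mx_norm.
rewrite -mulr_suml ler_wpM2r // ler_wpDl // (bigD1 i) //= lerDl.
by rewrite sumr_ge0 // => l _; rewrite sumr_ge0.
Qed.

Lemma mulmx_continuous (R : realType) m N (A : 'M[R]_(m, N)) :
  continuous (fun u : 'cV[R]_N => A *m u).
Proof.
have [b b0 Ab] := mulmx_bounded A.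
apply: (@bounded_linear_continuous _ _ _
  (mulmx A : {linear 'cV[R]_N -> 'cV[R]_m})).
apply/linear_boundedP; exists b; split; first exact: num_real.
by move=> r br u; apply: le_trans (Ab u) _; rewrite ler_wpM2r // ltW.
Qed.

(** * Gradients, derivatives along lines and the descent lemma *)

Lemma dotp_grad (R : realType) N (h : 'cV[R]_N -> R) (x v : 'cV[R]_N) :
  differentiable h x -> 'd h x v = dotp (grad h x) v.
Proof.
move=> hx; rewrite dotpE.
have {1}-> : v = \sum_i v i 0 *: delta_mx i 0.
  apply/colP => i; rewrite summxE (bigD1 i) //= big1 => [|j ji].
    by rewrite !mxE !eqxx mulr1 addr0.
  by rewrite !mxE eq_sym (negPf ji) mulr0.
rewrite linear_sum; apply: eq_bigr => i _.
by rewrite linearZ /= mxE deriveE // mulrC.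
Qed.

Lemma is_derive_line (R : realType) N (h : 'cV[R]_N -> R) (x v : 'cV[R]_N)
    (s : R) : differentiable h (x + s *: v) ->
  is_derive s 1 (fun s => h (x + s *: v)) (dotp (grad h (x + s *: v)) v).
Proof.
move=> hx.
have dl : is_diff s (fun s : R => x + s *: v) ( *:%R^~ v).
  have := is_diffD (is_diff_cst x s) (is_diff_scalel s v).
  by rewrite add0r.
have dhl : differentiable (h \o (fun s : R => x + s *: v)) s.
  exact: differentiable_comp.
apply: DeriveDef; first exact/diff_derivable.
rewrite deriveE // diff_comp //= diff_val scale1r.
exact: dotp_grad.
Qed.

(** Both sides are limits of the same difference quotient, so one-variable rules compute the
    directional derivatives that define [grad]. *)
Lemma derive_line (R : realType) N (h : 'cV[R]_N -> R) (x v : 'cV[R]_N) :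
  'D_v h x = 'D_1 (fun s : R => h (x + s *: v)) 0.
Proof.
rewrite /derive; set g := fun s : R => s^-1 *: ((h \o shift x) (s *: v) - h x).
set g1 := (X in _ = lim (X @ _)).
have -> : g1 = g; last reflexivity.
apply: funext => s; rewrite /g1 /g /= scale0r !addr0 [s *: 1]mulr1 (addrC x).
reflexivity.
Qed.

Lemma descent_lemma (R : realType) N (h : 'cV[R]_N -> R) (L : R)
    (x v : 'cV[R]_N) :
  (forall z, differentiable h z) -> lipschitz_grad L h ->
  h (x + v) <= h x + dotp (grad h x) v + L / 2 * dotp v v.
Proof.
move=> dh Lh.
(* Up to the constant [h x], [g] is the gap between the two sides along the segment from [x] to
   [x + v]. Cauchy-Schwarz and the Lipschitz bound give [g' <= 0] on it. *)
pose g (s : R) :=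
  h (x + s *: v) - s * dotp (grad h x) v - L / 2 * s ^+ 2 * dotp v v.
pose g' (s : R) :=
  dotp (grad h (x + s *: v)) v - dotp (grad h x) v - L * s * dotp v v.
have dg (s : R) : is_derive s 1 g (g' s).
  have := is_derive_line (dh (x + s *: v)) => ?.
  apply: is_derive_eq.
  rewrite /g' /GRing.scale /=; lra.
suff : g 1 <= g 0.
  rewrite /g scale1r scale0r addr0; lra.
apply: (@ler0_derive1_le_cc _ g 0 1) => //; rewrite ?in_itv /= ?lexx ?ler01 //.
- move=> r; rewrite in_itv /= => /andP[r0 _].
  rewrite derive1E derive_val /g' -dotpNl -dotpDl subr_le0.
  apply: le_trans (dotp_le_enorm _ _) _.
  apply: le_trans (ler_wpM2r (enorm_ge0 _) (Lh _ _)) _.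
  rewrite addrAC subrr add0r enormZ (gtr0_norm r0) -sqr_enorm expr2 !mulrA.
  exact: lexx.
- apply: derivable_within_continuous => r _; exact: ex_derive.
Qed.

(** * Symmetric matrices between 0 and 1, and their powers *)

Section ContractiveMatrix.
Variables (R : realType) (N : nat).
Implicit Types (A : 'M[R]_N) (u : 'cV[R]_N).

(** For symmetric [A] this says that the spectrum lies in [0, 1]; with quadratic forms no
    diagonalization enters. *)
Definition contractive_psd A : Prop :=
  [/\ A^T = A, forall u, 0 <= dotp u (A *m u)
    & forall u, dotp u (A *m u) <= dotp u u].

(* A - A^2 = (1 - A) A (1 - A) + A (1 - A) A *)
Lemma contractive_psd_sqr_le A u : contractive_psd A ->
  dotp (A *m u) (A *m u) <= dotp u (A *m u).
Proof.
case=> sA A0 A1.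
have := A0 (u - A *m u); have := A1 (A *m u).
rewrite !mulmxBr !dotpDl !dotpDr !dotpNl !dotpNr.
rewrite -[dotp u (A *m (A *m u))]opprK.
have e1 : dotp u (A *m (A *m u)) = dotp (A *m u) (A *m u).
  by rewrite dotp_mulmx sA.
rewrite e1; lra.
Qed.

Lemma contractive_psdX A k : contractive_psd A -> contractive_psd (A ^+ k).
Proof.
move=> cA; have [sA A0 A1] := cA.
have sX j : (A ^+ j)^T = A ^+ j.
  elim: j => [|j IH]; first by rewrite expr0 trmx1.
  by rewrite [in LHS]exprS trmx_mul IH sA exprSr.
have shift2 j u : dotp u (A ^+ j.+2 *m u) = dotp (A *m u) (A ^+ j *m (A *m u)).
  by rewrite dotp_mulmx sA exprSr exprS -!mulmxA.
(* [shift2] lowers the exponent by two, replacing [u] by [A *m u]; hence an induction on two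
   consecutive exponents at once. *)
have step j :
    (forall u, 0 <= dotp u (A ^+ j.+1 *m u) <= dotp u (A ^+ j *m u)) /\
    (forall u, 0 <= dotp u (A ^+ j.+2 *m u) <= dotp u (A ^+ j.+1 *m u)).
  elim: j => [|j [IH IH']]; split=> // u.
  - by rewrite expr1 expr0 mul1mx A0 A1.
  - by rewrite shift2 expr0 expr1 mul1mx dotp_ge0 contractive_psd_sqr_le.
  - by rewrite !(shift2 _ u); exact: IH.
split=> // [u|u]; first case: k => [|k].
- by rewrite expr0 mul1mx dotp_ge0.
- by have [/(_ u)/andP[]] := step k.
- elim: k => [|k IH]; first by rewrite expr0 mul1mx.
  by have [/(_ u)/andP[_ +] _] := step k; move=> /le_trans; apply.
Qed.

End ContractiveMatrix.

(** * Invertibility and spectral bounds for the Kronecker product of W and I_p *)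

Lemma positive_definite_unitmx (R : realType) n (A : 'M[R]_n) :
  positive_definite A -> A \in unitmx.
Proof.
move=> pA; rewrite -row_free_unit -kermx_eq0; apply/eqP/row_matrixP => i.
rewrite row0; set r := row i _.
have rA : r *m A = 0 by apply/sub_kermxP; exact: row_sub.
apply/eqP; apply: contraTT isT => r0.
(* For [r] in the left kernel, the quadratic form of [A] at [r^T] is [r *m A *m r^T], hence 0. *)
have /pA : r^T != 0 by rewrite trmx_eq0.
by rewrite /dotp trmxK mulmxA rA mul0mx mxE ltxx.
Qed.

Lemma kronI_unitmx (R : realType) n p (W : 'M[R]_n) :
  W \in unitmx -> kronI p W \in unitmx.
Proof.
move=> uW; suff /mulmx1_unit[] : kronI p W *m kronI p (invmx W) = 1%:M by [].
rewrite tensmx_mul mulmxV // mulmx1; apply/matrixP => k l.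
case: (mxtens_indexP k) => i j; case: (mxtens_indexP l) => i' j'.
rewrite tensmxE !mxE (can_eq (@mxtens_indexK _ _)) xpair_eqE.
by case: (i == i'); case: (j == j'); rewrite !(mulr0, mul0r, mulr1).
Qed.

Lemma sum_mxtens (R : realType) n p (E : 'I_(n * p) -> R) :
  \sum_k E k = \sum_i \sum_j E (mxtens_index (i, j)).
Proof.
rewrite pair_big /= (reindex (@mxtens_index n p)) /=.
  by apply: eq_bigr => -[].
by exists (@mxtens_unindex n p) => k _;
  rewrite (mxtens_indexK, mxtens_unindexK).
Qed.

(** Collects the j-th coordinates of all blocks. On each slice [kronI p W] acts as [W], so its
    quadratic form is a sum of forms of [W]. *)
Definition slice (R : realType) n p (u : 'cV[R]_(n * p)) (j : 'I_p) :
    'cV[R]_n :=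
  \col_i u (mxtens_index (i, j)) 0.

Lemma kronI_mulmxE (R : realType) n p (W : 'M[R]_n) (u : 'cV[R]_(n * p)) i j :
  (kronI p W *m u) (mxtens_index (i, j)) 0 = (W *m slice u j) i 0.
Proof.
rewrite mxE sum_mxtens [RHS]mxE; apply: eq_bigr => k _.
rewrite (bigD1 j) //= big1 ?addr0 => [|l lj].
  by rewrite tensmxE mxE eqxx mulr1 mxE.
by rewrite tensmxE mxE eq_sym (negPf lj) mulr0 mul0r.
Qed.

Lemma dotp_slice (R : realType) n p (u v : 'cV[R]_(n * p)) :
  dotp u v = \sum_j dotp (slice u j) (slice v j).
Proof.
rewrite dotpE sum_mxtens exchange_big; apply: eq_bigr => j _.
by rewrite dotpE; apply: eq_bigr => i _; rewrite !mxE.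
Qed.

Lemma slice_kronI (R : realType) n p (W : 'M[R]_n) (u : 'cV[R]_(n * p)) j :
  slice (kronI p W *m u) j = W *m slice u j.
Proof. by apply/colP => i; rewrite mxE kronI_mulmxE. Qed.

(** Weight u_i u_j <= (u_i^2 + u_j^2) / 2 by [W i j] and sum: unit row and column sums turn the
    right-hand side into [dotp u u]. *)
Lemma doubly_stochastic_form_le (R : realType) n (W : 'M[R]_n) (u : 'cV[R]_n) :
  doubly_stochastic W -> dotp u (W *m u) <= dotp u u.
Proof.
move=> [W0 Wr Wc].
have -> : dotp u (W *m u) = \sum_i \sum_j W i j * (u i 0 * u j 0).
  rewrite dotpE; apply: eq_bigr => i _; rewrite mxE mulr_sumr.
  by apply: eq_bigr => j _; rewrite mulrCA.
have -> : dotp u u = \sum_i \sum_j W i j * ((u i 0 ^+ 2 + u j 0 ^+ 2) / 2).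
  have e1 : \sum_i \sum_j W i j * (u i 0 ^+ 2 / 2) = dotp u u / 2.
    rewrite dotpE mulr_suml; apply: eq_bigr => i _.
    by rewrite -mulr_suml Wr mul1r expr2.
  have e2 : \sum_i \sum_j W i j * (u j 0 ^+ 2 / 2) = dotp u u / 2.
    rewrite exchange_big dotpE mulr_suml; apply: eq_bigr => i _.
    by rewrite -mulr_suml Wc mul1r expr2.
  rewrite [LHS]splitr -{1}e1 -e2 -big_split; apply: eq_bigr => i _ /=.
  by rewrite -big_split; apply: eq_bigr => j _ /=; rewrite mulrDl mulrDr.
apply: ler_sum => i _; apply: ler_sum => j _; apply: ler_wpM2l => //.
have := sqr_ge0 (u i 0 - u j 0); rewrite sqrrB; lra.
Qed.

Lemma kronI_contractive_psd (R : realType) n p (W : 'M[R]_n) :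
  W^T = W -> doubly_stochastic W -> positive_definite W ->
  contractive_psd (kronI p W).
Proof.
move=> sW dW pW; split=> [|u|u].
- by rewrite /kronI trmx_tens sW trmx1.
- rewrite dotp_slice; apply: sumr_ge0 => j _; rewrite slice_kronI.
  have [->|/pW/ltW//] := eqVneq (slice u j) 0.
  by rewrite mulmx0 dotp0r.
- rewrite !dotp_slice; apply: ler_sum => j _; rewrite slice_kronI.
  exact: doubly_stochastic_form_le.
Qed.

(** * Continuity and gradient of the Lyapunov function *)

Section Lyapunov.
Variables (R : realType) (N : nat) (F : 'cV[R]_N -> R) (Z : 'M[R]_N).
Variables (t : nat) (alpha : R).
Hypothesis dF : forall z, differentiable F z.
Hypothesis cZ : contractive_psd Z.
Let M := Z ^+ t.
Let B := M - M *m M.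

Lemma lyapunovE y :
  lyapunov F Z t alpha y = F (M *m y) + (2 * alpha)^-1 * dotp y (B *m y).
Proof.
by rewrite /lyapunov mul2n -addnn exprD mulmxBl dotpDr dotpNr mulrBr addrA.
Qed.

Lemma lyapunov_continuous : continuous (lyapunov F Z t alpha).
Proof.
have -> : lyapunov F Z t alpha =
    (fun y => F (M *m y) + (2 * alpha)^-1 * dotp y (B *m y)).
  by apply: funext => y; exact: lyapunovE.
move=> y; have cM : {for y, continuous (fun u : 'cV[R]_N => M *m u)}.
  exact: mulmx_continuous.
have cF : {for y, continuous (fun u : 'cV[R]_N => F (M *m u))}.
  exact: (continuous_comp cM (differentiable_continuous (dF (M *m y)))).
have cB : continuous (fun u : 'cV[R]_N => dotp u (B *m u)).
  have -> : (fun u : 'cV[R]_N => dotp u (B *m u)) =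
      (fun u => \sum_i u i 0 * (B *m u) i 0).
    by apply: funext => u; exact: dotpE.
  apply: continuous_big => [|i _ z]; first exact: add_continuous.
  apply: (@continuousM _ _ (fun u : 'cV[R]_N => u i 0) (fun u => (B *m u) i 0)).
    exact: coord_continuous.
  have cBz : {for z, continuous (fun u : 'cV[R]_N => B *m u)}.
    exact: mulmx_continuous.
  exact: (continuous_comp cBz (@coord_continuous _ _ _ i 0 _)).
apply: (continuousD (f := fun u => F (M *m u))
  (g := fun u => (2 * alpha)^-1 * dotp u (B *m u))); first exact: cF.
apply: (continuousM (s := cst (2 * alpha)^-1)); last exact: cB.
exact: cst_continuous.
Qed.

Let sM : M^T = M. Proof. by have [] := contractive_psdX t cZ. Qed.

Let sB : B^T = B. Proof. by rewrite linearB /= trmx_mul !sM. Qed.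

Lemma dotp_quad y v : dotp (y + v) (B *m (y + v)) =
  dotp y (B *m y) + 2 * dotp (B *m y) v + dotp v (B *m v).
Proof.
rewrite mulmxDr !dotpDl !dotpDr (dotp_mulmx B y v) sB (dotpC v (B *m y)).
rewrite (dotp_mulmx B y v) sB; ring.
Qed.

(** On a line through [y] the function is [F] on a line through [M *m y] plus a quadratic polynomial
    in [s]; symmetry of [M] and [B] brings its derivative to the form of an inner product with
    [v]. *)
Lemma grad_lyapunov y : alpha != 0 ->
  grad (lyapunov F Z t alpha) y = M *m grad F (M *m y) + alpha^-1 *: (B *m y).
Proof.
move=> a0.
suff D v : 'D_v (lyapunov F Z t alpha) y =
    dotp (M *m grad F (M *m y) + alpha^-1 *: (B *m y)) v.
  apply/colP => i; rewrite [LHS]mxE D dotpE (bigD1 i) //= big1 => [|j ji].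
    by rewrite addr0 [X in _ * X]mxE !eqxx mulr1.
  by rewrite [X in _ * X]mxE (negPf ji) mulr0.
rewrite derive_line.
have -> : (fun s : R => lyapunov F Z t alpha (y + s *: v)) =
  (fun s : R => F (M *m y + s *: (M *m v)) +
  ((2 * alpha)^-1 * (dotp y (B *m y) + 2 * s * dotp (B *m y) v +
    s ^+ 2 * dotp v (B *m v)))).
  apply: funext => s; rewrite lyapunovE dotp_quad mulmxDr -!scalemxAr.
  by rewrite !dotpZr dotpZl mulrA mulrA -expr2.
have := is_derive_line (s := 0) (v := M *m v) (dF (M *m y + 0 *: (M *m v))).
rewrite {1}scale0r addr0 => H.
apply: (@derive_val _ _ _ _ _ _ _ (is_derive_eq _ _)).
rewrite dotpDl (dotp_mulmx M _ v) sM dotpZl /GRing.scale /=.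
by field.
Qed.

End Lyapunov.

(* By concavity, the difference quotients of phi at a in the direction b - a
   dominate the chord slope. *)
Lemma desingularizing_tangent (R : realType) (eta : \bar R) (phi : R -> R)
    (a b : R) :
  desingularizing eta phi -> 0 < a -> (a%:E < eta)%E -> 0 <= b ->
  (b%:E < eta)%E -> phi b <= phi a + derive1 phi a * (b - a).
Proof.
move=> [[_ conc _] _ dphi _] a0 aeta b0 beta.
have [da _] := dphi a a0 aeta.
have dfa : differentiable phi a by exact/derivable1_diffP.
have dab : derivable phi a (b - a) by exact: diff_derivable.
have -> : derive1 phi a * (b - a) = 'D_(b - a) phi a.
  have : 'd phi a ((b - a) *: 1) = (b - a) *: 'd phi a 1 by rewrite linearZ.
  by rewrite [_ *: 1]mulr1 derive1E !deriveE // mulrC => ->.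
(* The limit is taken over [s] in (0, 1] only, where a + s (b - a) is a convex combination of [a]
   and [b], whatever the sign of b - a. *)
rewrite -lerBlDl; apply: (cvgr_to_ge (cvg_dnbhs_at_right dab)).
near=> s.
have s0 : 0 < s by near: s; exact: nbhs_right_gt.
have s1 : s <= 1 by near: s; exact: nbhs_right_le.
rewrite /GRing.scale /= ler_pdivlMl //.
have := conc b a s (conj b0 beta) (conj (ltW a0) aeta).
rewrite (ltW s0) s1 => /(_ isT).
rewrite (_ : s * b + (1 - s) * a = s * (b - a) + a); [lra|ring].
Unshelve. all: by end_near. Qed.

(** * Convergence of an abstract descent sequence under the KL inequality *)

Section KLDescent.
Variables (R : realType) (N : nat) (h : 'cV[R]_N -> R).
Variables (y : nat -> 'cV[R]_N) (g : nat -> R) (a b c : R).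
Hypotheses (a_gt0 : 0 < a) (b_gt0 : 0 < b) (c_gt0 : 0 < c).
Hypothesis g_ge0 : forall k, 0 <= g k.
Hypothesis h_desc : forall k, h (y k.+1) <= h (y k) - c * g k ^+ 2.
Hypothesis grad_le : forall k, enorm (grad h (y k)) <= a * g k.
Hypothesis step_le : forall k, `|y k.+1 - y k| <= b * g k.
Variables (yinf : 'cV[R]_N) (sigma : nat -> nat).
Hypothesis h_cont : {for yinf, continuous h}.
Hypothesis sigma_incr : {homo sigma : i j / (i < j)%N}.
Hypothesis y_sub_cvg : y (sigma k) @[k --> \oo] --> yinf.

Let h_nincr k m : (k <= m)%N -> h (y m) <= h (y k).
Proof.
move=> /subnKC <-; elim: (m - k)%N => [|i IH]; first by rewrite addn0.
rewrite addnS; apply: le_trans (h_desc _) _; apply: le_trans IH.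
by rewrite lerBlDr lerDl mulr_ge0 ?sqr_ge0 // ltW.
Qed.

Let sigma_ge k : (k <= sigma k)%N.
Proof.
by elim: k => // k IH; apply: leq_ltn_trans IH (sigma_incr (ltnSn k)).
Qed.

Let sigma_near k : \forall j \near \oo, (k <= sigma j)%N.
Proof. by exists k => // j /= kj; apply: leq_trans kj (sigma_ge j). Qed.

Let h_sub_cvg : h (y (sigma k)) @[k --> \oo] --> h yinf.
Proof. exact: (cvg_comp _ _ y_sub_cvg h_cont). Qed.

(** The values are nonincreasing and a subsequence of them tends to [h yinf]. *)
Let h_ge k : h yinf <= h (y k).
Proof.
apply: (cvgr_to_le h_sub_cvg); near=> j; apply: h_nincr; near: j.
exact: sigma_near.
Unshelve. all: by end_near. Qed.

(** At the minimal value no decrease is left, so [g] and with it every later step vanishes; the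
    constant reached must be the subsequential limit. *)
Lemma descent_stationary k1 : h (y k1) <= h yinf ->
  forall k, (k1 <= k)%N -> y k = yinf.
Proof.
move=> hk1.
have st k : (k1 <= k)%N -> y k = y k1.
  move=> /subnKC <-; elim: (k - k1)%N => [|i IH]; first by rewrite addn0.
  rewrite addnS; apply/eqP; rewrite -IH -subr_eq0 -normr_le0.
  apply: le_trans (step_le _) _; rewrite pmulr_rle0 //.
  have := h_desc (k1 + i); have := h_ge (k1 + i).+1; rewrite IH => h1 h2.
  have : c * g (k1 + i) ^+ 2 <= 0 by lra.
  by rewrite pmulr_rle0 // real_exprn_even_le0 ?num_real //= => /eqP ->.
suff <- : y k1 = yinf by [].
apply: (@cvg_unique _ _ (y (sigma k) @[k --> \oo])) => //.
apply: cvg_near_cst.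
near=> j; apply: st; near: j; exact: sigma_near.
Unshelve. all: by end_near. Qed.

(* Along the iterates the potential |y k - yinf| + C phi (h (y k) - h yinf) does
   not increase as long as the KL inequality holds, so that an iterate with a
   small potential traps all the later ones in U. *)
Lemma KL_descent_trapped (eta : \bar R) (U : set 'cV[R]_N) (phi : R -> R)
    (e : R) :
  (forall k, h yinf < h (y k)) -> KL_data h yinf eta U phi -> 0 < e ->
  exists k0 : nat, (0 < k0)%N /\ forall k, (k0 <= k)%N ->
    [/\ `|y k - yinf| < e, KL_range h yinf eta (y k)
      & KL_inequality h yinf phi (y k)].
Proof.
move=> h_gt [eta0 /nbhs_ballP[r0 /= r0_gt0 rU] dphi KL] e0.
have [[cphi _ phi_ge0] phi0 _ dphi_gt0] := dphi.
pose D k := h (y k) - h yinf.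
have D0 k : 0 < D k by rewrite subr_gt0.
(* Radius [r0] keeps the iterates in [U]; radius [e] is the closeness asked for. *)
pose r := Num.min r0 e.
have r_gt0 : 0 < r by rewrite lt_min r0_gt0.
(* Chosen so that c g_m <= a (phi_m - phi_(m+1)) becomes b g_m <= C (phi_m - phi_(m+1)), a bound on
   the step. *)
pose C := b * a / c.
have C0 : 0 < C by rewrite divr_gt0 ?mulr_gt0.
have D_cvg : D (sigma k) @[k --> \oo] --> (0 : R).
  by rewrite -(subrr (h yinf)); apply: cvgB => //; exact: cvg_cst.
have near_eta : \forall s \near (0 : R), (s%:E < eta)%E.
  case: eta eta0 {KL dphi cphi phi_ge0 dphi_gt0} => [q|_|//].
    by rewrite lte_fin => q0; near do rewrite lte_fin; exact: lt_nbhsl.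
  by exists 1 => //= s _; exact: ltry.
(* [phi] is continuous at 0 only within [0, eta), whence the two premises on [s]. *)
have near_phi : \forall s \near (0 : R), 0 <= s -> (s%:E < eta)%E ->
    phi s < r / 2 / C.
  have r2C : 0 < r / 2 / C by rewrite divr_gt0 // divr_gt0.
  move/subspace_continuousP : cphi => /(_ 0 (conj (lexx _) eta0)) cv.
  have {}cv : phi s @[s --> within [set s | 0 <= s /\ (s%:E < eta)%E] (nbhs 0)]
      --> (0 : R) by rewrite -[X in _ --> X]phi0; exact: cv.
  have : \forall s \near (0 : R),
      (0 <= s /\ (s%:E < eta)%E) -> phi s < r / 2 / C.
    exact: cvgr_lt cv _ r2C.
  by apply: filterS => s Hs s0 se; exact: Hs.
(* Each of the two terms of the potential gets half of [r]; [sigma j] will be the threshold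
   index. *)
have [j [j0 jy jeta jphi]] : exists j, [/\ (0 < sigma j)%N,
    `|y (sigma j) - yinf| < r / 2, ((D (sigma j))%:E < eta)%E
    & phi (D (sigma j)) < r / 2 / C].
  have r2 : 0 < r / 2 by rewrite divr_gt0.
  have jphi : \forall j \near \oo, 0 <= D (sigma j) ->
      ((D (sigma j))%:E < eta)%E -> phi (D (sigma j)) < r / 2 / C.
    exact: D_cvg near_phi.
  have jeta : \forall j \near \oo, ((D (sigma j))%:E < eta)%E.
    exact: D_cvg near_eta.
  have jy : \forall j \near \oo, `|y (sigma j) - yinf| < r / 2.
    exact: cvgr_distC_lt.
  near \oo => j; exists j.
  have je : ((D (sigma j))%:E < eta)%E by near: j.
  split=> //; [near: j; exact: sigma_near|by near: j|].
  by apply: (near jphi j) => //; exact: ltW.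
have De k : (sigma j <= k)%N -> ((D k)%:E < eta)%E.
  by move=> jk; apply: le_lt_trans jeta; rewrite lee_fin lerB // h_nincr.
have range k : (sigma j <= k)%N -> KL_range h yinf eta (y k).
  by move=> /De; split=> //; rewrite -lteBlDl.
have inU k : `|y k - yinf| < r -> U (y k).
  move=> yr; apply: rU; rewrite -ball_normE /= distrC.
  by apply: lt_le_trans yr _; rewrite ge_min lexx.
have inv k : (sigma j <= k)%N -> `|y k - yinf| + C * phi (D k) < r.
  move=> /subnKC <-; elim: (k - sigma j)%N => [|i].
    rewrite addn0 [r]splitr; apply: ltrD => //.
    by rewrite mulrC -ltr_pdivlMr.
  rewrite addnS; set m := (sigma j + i)%N => IH.
  have jm : (sigma j <= m)%N by exact: leq_addr.
  have jm1 : (sigma j <= m.+1)%N by exact: leqW.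
  have phm : 0 <= phi (D m) by apply: phi_ge0; split; [exact: ltW | exact: De].
  have Um : U (y m).
    by apply: inU; apply: le_lt_trans IH; rewrite lerDl mulr_ge0 // ltW.
  have KLm : 1 <= derive1 phi (D m) * enorm (grad h (y m)).
    exact: KL Um (range _ jm).
  have d0 : 0 < derive1 phi (D m) by apply: dphi_gt0 => //; exact: De.
  have tan := desingularizing_tangent dphi (D0 m) (De _ jm)
    (ltW (D0 m.+1)) (De _ jm1).
  have DD : D m.+1 - D m <= - (c * g m ^+ 2).
    by have := h_desc m; rewrite /D; lra.
  have ag : 1 <= derive1 phi (D m) * (a * g m).
    by apply: le_trans KLm _; rewrite ler_pM2l.
  (* Multiplying the KL inequality by c g_m makes the squared decrease c g_m^2 appear on its right;
     the tangent inequality bounds phi' times that decrease by a telescoping difference. *)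
  have gle : c * g m <= a * (phi (D m) - phi (D m.+1)).
    have h1 : derive1 phi (D m) * (D m.+1 - D m) <=
        derive1 phi (D m) * - (c * g m ^+ 2).
      by rewrite ler_pM2l.
    have h2 : c * g m * 1 <= c * g m * (derive1 phi (D m) * (a * g m)).
      by rewrite ler_wpM2l // mulr_ge0 // ltW.
    have h3 : derive1 phi (D m) * (c * g m ^+ 2) <= phi (D m) - phi (D m.+1).
      by lra.
    have h4 : a * (derive1 phi (D m) * (c * g m ^+ 2)) <=
        a * (phi (D m) - phi (D m.+1)).
      by rewrite ler_pM2l.
    by move: h2; rewrite mulr1 => /le_trans; apply; apply: le_trans h4; lra.
  apply: le_lt_trans IH.
  have -> : y m.+1 - yinf = (y m.+1 - y m) + (y m - yinf).
    by rewrite addrA subrK.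
  have := ler_normD (y m.+1 - y m) (y m - yinf).
  have : b * g m <= C * (phi (D m) - phi (D m.+1)).
    by rewrite /C [leRHS]mulrAC ler_pdivlMr // -!mulrA ler_pM2l // mulrC.
  have := step_le m; lra.
exists (sigma j); split=> // k jk.
have phk : 0 <= phi (D k) by apply: phi_ge0; split; [exact: ltW | exact: De].
have yr : `|y k - yinf| < r.
  by apply: le_lt_trans (inv _ jk); rewrite lerDl mulr_ge0 // ltW.
split; [|exact: range|exact: KL (inU _ yr) (range _ jk)].
by apply: lt_le_trans yr _; rewrite ge_min lexx orbT.
Unshelve. all: by end_near. Qed.

Lemma KL_descent : KL_property h yinf ->
  (forall (eta : \bar R) (U : set 'cV[R]_N) (phi : R -> R),
      KL_data h yinf eta U phi ->
      exists k0 : nat, (0 < k0)%N /\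
        ((forall k, (k0 <= k)%N -> y k = yinf) \/
         (forall k, (k0 <= k)%N ->
            KL_range h yinf eta (y k) /\ KL_inequality h yinf phi (y k))))
  /\ y k @[k --> \oo] --> yinf.
Proof.
move=> [eta0 [U0 [phi0 KL0]]].
(* Either the limit value is reached and the sequence is stationary, or all values stay strictly
   above it and [phi'] is evaluated at positive arguments. *)
have [[k1 hk1]|h_gt] := pselect (exists k, h (y k) <= h yinf).
  have st := descent_stationary hk1.
  split=> [eta U phi _|].
    by exists k1.+1; split=> //; left => k /ltnW; exact: st.
  by apply: cvg_near_cst; exists k1 => // k /= /st ->.
have {}h_gt k : h yinf < h (y k).
  by rewrite ltNge; apply/negP => hk; apply: h_gt; exists k.
split=> [eta U phi KL|].
  (* No particular closeness is asked for here, so radius 1 serves. *)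
  have [k0 [k00 H]] := KL_descent_trapped h_gt KL ltr01.
  by exists k0; split=> //; right => k /H[].
apply/cvgrPdist_lt => e e0.
have [k0 [_ H]] := KL_descent_trapped h_gt KL0 e0.
by exists k0 => // k /= /H[+ _ _]; rewrite distrC.
Qed.

End KLDescent.

(** * Gradient and decrease of the Lyapunov function along NEAR-DGD *)

Section NearDGD.
Variables (R : realType) (N : nat) (F : 'cV[R]_N -> R) (Z : 'M[R]_N).
Variables (t : nat) (alpha L : R) (x y : nat -> 'cV[R]_N).
Hypothesis dF : forall z, differentiable F z.
Hypothesis F_lipschitz : lipschitz_grad L F.
Hypothesis cZ : contractive_psd Z.
Hypothesis alpha_gt0 : 0 < alpha.
Hypothesis xy_iterates : near_dgd F Z t alpha x y.
Let M := Z ^+ t.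

Let gradF k : grad F (M *m y k) = alpha^-1 *: (M *m y k - y k.+1).
Proof.
have [<- ->] := xy_iterates k.
by rewrite opprB addrC subrK scalerA mulVf ?scale1r // gt_eqF.
Qed.

(** Inserting the update rule, solved for the gradient of [F], into [grad_lyapunov], the two terms
    in [M *m M *m y k] cancel. *)
Lemma near_dgd_grad_lyapunov k :
  grad (lyapunov F Z t alpha) (y k) = - (alpha^-1 *: (M *m (y k.+1 - y k))).
Proof.
rewrite grad_lyapunov ?gt_eqF // -/M gradF -scalemxAr -scalerDr -scalerN.
congr (_ *: _); rewrite mulmxBl !mulmxBr -mulmxA opprB.
by rewrite [LHS]addrC addrA subrK.
Qed.

(** With d the step, the descent lemma in direction M d leaves no term linear in d: these cancel
    against the quadratic part. What remains is -(<d, M d> + |M d|^2) / (2 alpha) + (L / 2) |M d|^2,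
    and <d, M d> >= |M d|^2. *)
Lemma near_dgd_lyapunov_decr k :
  lyapunov F Z t alpha (y k.+1) <= lyapunov F Z t alpha (y k)
    - (alpha^-1 - L / 2) * enorm (M *m (y k.+1 - y k)) ^+ 2.
Proof.
have cM : contractive_psd M by exact: contractive_psdX.
have [sM _ _] := cM.
set d := y k.+1 - y k; set u := y k.
have -> : y k.+1 = u + d by rewrite addrC subrK.
have Fle := descent_lemma (M *m u) (M *m d) dF F_lipschitz.
rewrite !lyapunovE // -/M dotp_quad // -/M mulmxDr sqr_enorm.
have tr v w : dotp (M *m v) w = dotp v (M *m w) by rewrite dotp_mulmx sM.
rewrite gradF dotpZl -/u -[y k.+1](subrK u) -/d dotpDl dotpNl dotpDl in Fle.
have -> : dotp ((M - M *m M) *m u) d = dotp u (M *m d) - dotp (M *m u) (M *m d).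
  by rewrite mulmxBl dotpDl dotpNl -mulmxA !tr.
have -> : dotp d ((M - M *m M) *m d) = dotp d (M *m d) - dotp (M *m d) (M *m d).
  by rewrite mulmxBl dotpDr dotpNr -mulmxA tr.
have := contractive_psd_sqr_le d cM.
have ai : 0 < alpha^-1 by rewrite invr_gt0.
rewrite -(ler_pM2l ai) invfM; lra.
Qed.

End NearDGD.

(** * Differentiability of the aggregate objective, and the convergence theorem *)

Lemma block_mulmx (R : realType) n p (i : 'I_n) (z : 'cV[R]_(n * p)) :
  block z i = (\matrix_(j, k) (k == mxtens_index (i, j))%:R) *m z.
Proof.
apply/colP => j; rewrite !mxE (bigD1 (mxtens_index (i, j))) //=.
rewrite mxE eqxx mul1r big1 ?addr0 // => k kj.
by rewrite mxE (negPf kj) mul0r.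
Qed.

Lemma differentiable_sum_blocks (R : realType) n p (f : 'I_n -> 'cV[R]_p -> R)
    z :
  (forall i v, differentiable (f i) v) -> differentiable (sum_blocks f) z.
Proof.
move=> df.
have -> : sum_blocks f = \sum_(i < n) (f i \o (fun v => block v i)).
  by apply: funext => v; rewrite fct_sumE.
apply: differentiable_sum => i; apply: differentiable_comp => //.
set P : 'M[R]_(p, n * p) := \matrix_(j, k) (k == mxtens_index (i, j))%:R.
have -> : (fun v => block v i) =
    (mulmx P : {linear 'cV[R]_(n * p) -> 'cV[R]_p}).
  by apply: funext => v; rewrite block_mulmx.
exact/linear_differentiable/mulmx_continuous.
Qed.

(* In (i), phi' is only defined on (0, eta): if the iterates reach yinf after
   finitely many steps then they stay there, the left-hand side of the KL
   inequality is undefined, and grad L_t is 0.  The first alternative is exactly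
   that case. *)
Theorem mainTheorem1 (R : realType) (n p : nat) (e : rel 'I_n)
    (f : 'I_n -> 'cV[R]_p -> R) (W : 'M[R]_n) (L : R)
    (t : nat) (alpha : R) (x y : nat -> 'cV[R]_(n * p))
    (yinf : 'cV[R]_(n * p)) (sigma : nat -> nat)
    (F := sum_blocks f) (Z := kronI p W) (Lt := lyapunov F Z t alpha)
    (e_connected : connected_graph e)
    (f_diff : forall i z, differentiable (f i) z)
    (W_consensus : consensus_matrix e W)
    (L_gt0 : 0 < L)
    (F_lipschitz : lipschitz_grad L F)
    (F_coercive : coercive F)
    (t_gt0 : (0 < t)%N)
    (alpha_gt0 : 0 < alpha)
    (alpha_lt : alpha < 2 / L)
    (Lt_KL : KL_function Lt)
    (xy_iterates : near_dgd F Z t alpha x y)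
    (sigma_incr : {homo sigma : i j / (i < j)%N})
    (y_sub_cvg : y (sigma k) @[k --> \oo] --> yinf) :
  (forall (eta : \bar R) (U : set 'cV[R]_(n * p)) (phi : R -> R),
      KL_data Lt yinf eta U phi ->
      exists k0 : nat, (0 < k0)%N /\
        ((forall k, (k0 <= k)%N -> y k = yinf) \/
         (forall k, (k0 <= k)%N ->
            KL_range Lt yinf eta (y k) /\ KL_inequality Lt yinf phi (y k))))
  /\ y k @[k --> \oo] --> yinf.
Proof.
have [sW dW pW _ _] := W_consensus.
have cZ : contractive_psd Z by exact: kronI_contractive_psd.
have uM : Z ^+ t \in unitmx.
  have uZ : Z \in unitmx by exact/kronI_unitmx/positive_definite_unitmx.
  by elim: (t) => [|s IH]; rewrite ?unitmx1 // exprS unitmx_mul uZ.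
have dF z : differentiable F z by exact: differentiable_sum_blocks.
(* A bound for the inverse of Z^t recovers the step from its image under Z^t. *)
have [b b0 Mb] := mulmx_bounded (invmx (Z ^+ t)).
(* The steplength condition alpha < 2 / L is what makes the decrease constant positive. *)
have c0 : 0 < alpha^-1 - L / 2.
  rewrite subr_gt0 -(invrK (L / 2)) ltf_pV2 ?posrE ?invr_gt0 ?divr_gt0 //.
  by rewrite invf_div.
apply: (@KL_descent _ _ Lt y (fun k => enorm (Z ^+ t *m (y k.+1 - y k)))
  alpha^-1 b (alpha^-1 - L / 2) _ _ _ _ _ _ _ yinf sigma) => //.
- by rewrite invr_gt0.
- by move=> k; exact: enorm_ge0.
- by move=> k; exact: near_dgd_lyapunov_decr xy_iterates k.
- move=> k; rewrite /Lt (near_dgd_grad_lyapunov dF cZ alpha_gt0 xy_iterates).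
  by rewrite enormN enormZ gtr0_norm // invr_gt0.
- move=> k; rewrite -[X in `|X| <= _](mulKmx uM).
  by apply: le_trans (Mb _) _; rewrite ler_pM2l // mx_norm_le_enorm.
- exact: lyapunov_continuous.
Qed.
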